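(* Let $G$ be a simple graph of order $n$ with $m$ edges, let $X$ be uniformly distributed on $[-1,1]$, and let $d\ge 2$ be an even integer. Suppose that either (a) $G$ has no triangle, or (b) $G$ has no square and $m\ge 9$. Then $$\|G\|_{X,d}^d\ge\frac{2(2\sqrt{m})^d}{(d+2)!}.$$ Moreover, equality is realized in case (a) by any complete bipartite graph and in case (b) by the star graph $S_n=K_{1,n-1}$.
   Context: For a simple graph $G$ of order $n$ with adjacency eigenvalues $\lambda_1,\dots,\lambda_n$, the random vector norm is $$\|G\|_{X,d}=\Gamma(d+1)^{-1/d}\bigl(\mathbb{E}|\lambda_1X_1+\cdots+\lambda_nX_n|^d\bigr)^{1/d},$$ where $X_1,\dots,X_n$ are i.i.d. copies of $X$. ''No triangle'' (resp. ''no square'') means that $G$ contains no $3$-cycle (resp. no $4$-cycle) as a (not necessarily induced) subgraph. *)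

(* Defs.v *)
From HB Require Import structures.
From mathcomp Require Import all_boot all_order all_algebra.
From mathcomp Require Import complex.
From mathcomp Require Import all_classical all_reals all_analysis.

Set Implicit Arguments.
Unset Strict Implicit.
Unset Printing Implicit Defensive.

Import Order.TTheory GRing.Theory Num.Theory.

Local Open Scope complex_scope.
Local Open Scope classical_set_scope.
Local Open Scope ring_scope.

Record sgraph (n : nat) := SGraph {
  adj :> rel 'I_n;
  adj_sym : symmetric adj;
  adj_irr : irreflexive adj }.

(* Each edge {x, y} is counted once, through the ordered pair with x < y. *)
Definition num_edges n (G : sgraph n) : nat :=
  #|[set p : 'I_n * 'I_n | (p.1 < p.2)%N && G p.1 p.2]%SET|.

(* [ucycle] only compares consecutive vertices of a duplicate-free sequence,
   so chords are allowed: the cycles need not be induced. *)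
Definition has_cycle_of_length n (G : sgraph n) (k : nat) : Prop :=
  exists s : k.-tuple 'I_n, ucycle G s.

Definition triangle_free n (G : sgraph n) : Prop := ~ has_cycle_of_length G 3.
Definition square_free n (G : sgraph n) : Prop := ~ has_cycle_of_length G 4.

Definition is_complete_bipartite n (G : sgraph n) : Prop :=
  exists A : {set 'I_n}, [/\ A != finset.set0, (~: A)%SET != finset.set0
    & forall x y, G x y = ((x \in A) != (y \in A))].

Definition is_star n (G : sgraph n) : Prop :=
  exists c : 'I_n, forall x y, G x y = ((x == c) != (y == c)).

Definition adjmx (R : realType) n (G : sgraph n) : 'M[R]_n :=
  \matrix_(i, j) (G i j)%:R.

Lemma char_poly_conj (F : fieldType) n (P A : 'M[F]_n) : P \in unitmx ->
  char_poly (invmx P *m A *m P) = char_poly A.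
Proof.
move=> Pu; rewrite /char_poly.
pose Q : 'M[{poly F}]_n := map_mx polyC P.
pose Q' : 'M[{poly F}]_n := map_mx polyC (invmx P).
have QQ : Q' *m Q = 1%:M by rewrite -map_mxM mulVmx// map_mx1.
have -> : char_poly_mx (invmx P *m A *m P) = Q' *m char_poly_mx A *m Q.
  rewrite /char_poly_mx !map_mxM mulmxBr mulmxBl -/Q -/Q'; congr (_ - _).
  by rewrite scalar_mxC -mulmxA QQ mulmx1.
by rewrite !det_mulmx mulrAC -det_mulmx QQ det1 mul1r.
Qed.

Lemma symmetric_char_poly_split (R : realType) n (A : 'M[R]_n) :
  A^T = A ->
  exists l : 'rV[R]_n, char_poly A = \prod_(i < n) ('X - (l 0 i)%:P).
Proof.
move=> Asym; pose f := real_complex R; pose B := map_mx f A.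
have Breal : B \is a mxOver Num.real.
  by apply/mxOverP => i j; rewrite mxE complex_real.
have Bsym : B \is symmetricmx.
  by apply/is_hermitianmxP; rewrite expr0 scale1r map_mx_id// /B map_trmx Asym.
have Bherm := realsym_hermsym Bsym Breal.
have /mxOverP Dreal := hermitian_spectral_diag_real Bherm.
have /orthomx_spectralP BE := hermitian_normalmx Bherm.
exists (\row_i complex.Re (spectral_diag B 0 i)).
apply: (@map_poly_inj _ _ f).
rewrite map_char_poly -/B {1}BE char_poly_conj ?spectral_unit//.
rewrite char_poly_trig ?is_diag_mx_is_trig ?diag_mx_is_diag// rmorph_prod.
apply: eq_bigr => i _ /=; rewrite rmorphB/= map_polyX map_polyC/= !mxE eqxx.
by rewrite mulr1n RRe_real.
Qed.

(* The eigenvalues of a real symmetric matrix, repeated with multiplicity and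
   in an unspecified order. *)
Definition eigenvalues_mx (R : realType) n (A : 'M[R]_n) : 'rV[R]_n :=
  xget 0 [set l : 'rV[R]_n |
          char_poly A = \prod_(i < n) ('X - (l 0 i)%:P)].

Lemma eigenvalues_mxP (R : realType) n (A : 'M[R]_n) : A^T = A ->
  char_poly A = \prod_(i < n) ('X - (eigenvalues_mx A 0 i)%:P).
Proof.
move=> /symmetric_char_poly_split[l hl]; rewrite /eigenvalues_mx.
by case: xgetP => [_ -> //|/(_ l)]; case.
Qed.

Lemma adjmx_sym (R : realType) n (G : sgraph n) : (adjmx R G)^T = adjmx R G.
Proof. by apply/matrixP => i j; rewrite !mxE adj_sym. Qed.

Definition Gamma (R : realType) (x : R) : R :=
  Rintegral lebesgue_measure `]0, +oo[ (fun t => t `^ (x - 1) * expR (- t)).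

Section Probability.
Context (R : realType) (d : measure_display) (T : measurableType d)
  (P : probability T R).

Definition mutually_independent n (X : 'I_n -> {RV P >-> R}) : Prop :=
  forall (J : {set 'I_n}) (B : 'I_n -> set R),
    (forall i, i \in J -> measurable (B i)) ->
    (P (\bigcap_(i in [set` J]) (X i @^-1` B i)) =
     \prod_(i in J) P (X i @^-1` B i))%E.

Definition iid_with_law n (mu : probability (measurableTypeR R) R) (X : 'I_n -> {RV P >-> R})
  : Prop :=
  mutually_independent X /\
  forall i (B : set R), measurable B -> distribution P (X i) B = mu B.

(* [X] plays the part of the i.i.d. copies X_1, ..., X_n; the value depends
   only on their common law. *)
Definition random_vector_norm n (G : sgraph n) (X : 'I_n -> {RV P >-> R})
  (r : R) : R :=
  Gamma (r + 1) `^ (- r^-1) *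
  (fine 'E_P[fun w =>
     `| \sum_(i < n) eigenvalues_mx (adjmx R G) 0 i * X i w | `^ r]) `^ (r^-1).

End Probability.

Lemma ltrN1_1 (R : realType) : -1 < 1 :> R.
Proof. by rewrite -subr_gt0 opprK addr_gt0. Qed.

Definition uniformN11 (R : realType) : probability (measurableTypeR R) R :=
  uniform_prob (@ltrN1_1 R).

(* Main.v *)
Require Import Defs.
From HB Require Import structures.
From mathcomp Require Import all_boot all_order all_algebra.
From mathcomp Require Import ring lra zify.
From mathcomp Require Import all_classical all_reals all_analysis.
From mathcomp Require Import measurable_realfun.

(** Write g(a) = sum_j a^j s^j / (2j+1)!, so that g(a) at s = t^2 is
sinh(sqrt(a) t) / (sqrt(a) t), the moment generating function of sqrt(a) X for
X uniform on [-1, 1].  For even d = 2K, the d-th power of the norm is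
E (sum_i l_i X_i)^d / d!, which by independence is the coefficient of s^K in
the product of the g(l_i^2), the l_i being the adjacency eigenvalues
([random_vector_norm_even]).  Everything then depends on the numbers
a_i = l_i^2 >= 0, whose sum is the trace 2m of the squared adjacency matrix
([sum_sqr_eigenvalues]).

The first ingredient is that the coefficients of the product of the g(a_i) are
Schur concave in the a_i: they grow when two of the a_i are moved towards each
other with a fixed sum ([sinhc_poly_spread]).  Therefore, among all families
with 0 <= a_i <= M and sum 2M, the extreme family (M, M, 0, ..., 0) has the
smallest coefficient, and the identity
g(M)^2 = (cosh(2 sqrt(M) t) - 1) / (2 M t^2) evaluates it; with M = m this is
the stated bound ([coef_prod_sinhc_poly_ge]).

The second ingredient is that no eigenvalue exceeds sqrt(m) in absolute value.
Scale the absolute values of an eigenvector to have maximum 1, attained at v.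
This gives a vector y with mu y <= A y for mu = |l|, so mu^2 is at most
(A^2 y)_v, and A^2 counts the walks of length two that start at v.  Without
triangles, these walks are at most as many as the edges.  Without squares, two
vertices have at most one common neighbour; applying mu y <= A y once more to
the neighbours of v and to the vertices at distance two bounds the walks by m
as soon as mu >= 3, and mu < 3 gives mu^2 < 9 <= m ([eigenvalue_sqr_le]).

For a complete bipartite graph each l_i^2 is 0 or m
([cut_graph_sqr_eigenvalue]).  As they sum to 2m, exactly two of them equal m
(unless m = 0), so the extreme family is attained. *)

Set Implicit Arguments.
Unset Strict Implicit.
Unset Printing Implicit Defensive.

Import Order.TTheory GRing.Theory Num.Theory.
Local Open Scope ring_scope.

(** * Binomial sums over indices of one parity *)

(** With a = p^2 and b = q^2, this sum and the next one are the even and the odd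
part of (p + q)^(2j): (p + q)^(2j) = [even_binomial_sum] + p q
[odd_binomial_sum]. *)
Definition even_binomial_sum (R : comPzRingType) (a b : R) (j : nat) : R :=
  \sum_(i < j.+1) (a ^+ i * b ^+ (j - i)) *+ 'C(2 * j, 2 * i).

Definition odd_binomial_sum (R : comPzRingType) (a b : R) (j : nat) : R :=
  \sum_(i < j) (a ^+ i * b ^+ (j.-1 - i)) *+ 'C(2 * j, (2 * i).+1).

(** This recurrence and the next one are multiplication by
(p + q)^2 = (a + b) + 2 p q, split into even and odd parts.  They see a and b
only through a + b and a b, which is what makes the sums monotone in a b. *)
Lemma even_binomial_sumS (R : comPzRingType) (a b : R) j :
  even_binomial_sum a b j.+1 =
  (a + b) * even_binomial_sum a b j + (a * b * odd_binomial_sum a b j) *+ 2.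
Proof.
have e1 : \sum_(i < j.+2) (a ^+ i * b ^+ (j.+1 - i)) *+ 'C(2 * j, 2 * i) =
    b * even_binomial_sum a b j.
  rewrite big_ord_recr/= bin_small ?mulr0n ?addr0; last by lia.
  rewrite /even_binomial_sum mulr_sumr; apply: eq_bigr => i _.
  by rewrite (subSn (leq_ord i)) exprS mulrnAr mulrCA.
have e2 : \sum_(i < j.+1) (a ^+ i.+1 * b ^+ (j - i)) *+ 'C(2 * j, 2 * i) =
    a * even_binomial_sum a b j.
  rewrite /even_binomial_sum mulr_sumr; apply: eq_bigr => i _.
  by rewrite exprS mulrnAr mulrA.
have e3 : \sum_(i < j.+1) (a ^+ i.+1 * b ^+ (j - i)) *+ 'C(2 * j, (2 * i).+1) =
    a * b * odd_binomial_sum a b j.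
  rewrite big_ord_recr/= bin_small ?mulr0n ?addr0; last by lia.
  rewrite /odd_binomial_sum mulr_sumr; apply: eq_bigr => i _.
  rewrite (_ : j - i = (j.-1 - i).+1)%N; last by have := ltn_ord i; lia.
  by rewrite !exprS mulrnAr -!mulrA; congr (_ * _ *+ _); rewrite mulrCA.
rewrite mulrDl -e2 -e1 -e3 {1}/even_binomial_sum.
rewrite [X in _ = _ + X + _]big_ord_recl/= [LHS]big_ord_recl/=.
rewrite !muln0 !bin0 addrAC [RHS]addrCA -!addrA; congr (_ + _).
rewrite -!big_split; apply: eq_bigr => i _ /=.
rewrite /bump/= !add1n subSS -!mulrnDr; congr (_ *+ _).
rewrite (_ : 2 * j.+1 = (2 * j).+2)%N; last by lia.
rewrite (_ : 2 * i.+1 = (2 * i).+2)%N; last by lia.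
rewrite !binS; lia.
Qed.

Lemma odd_binomial_sumS (R : comPzRingType) (a b : R) j :
  odd_binomial_sum a b j.+1 =
  (even_binomial_sum a b j) *+ 2 + (a + b) * odd_binomial_sum a b j.
Proof.
have e1 : \sum_(i < j.+1) (a ^+ i * b ^+ (j - i)) *+ 'C(2 * j, (2 * i).+1) =
    b * odd_binomial_sum a b j.
  rewrite big_ord_recr/= bin_small ?mulr0n ?addr0; last by lia.
  rewrite /odd_binomial_sum mulr_sumr; apply: eq_bigr => i _.
  rewrite (_ : j - i = (j.-1 - i).+1)%N; last by have := ltn_ord i; lia.
  by rewrite exprS mulrnAr mulrCA.
have e2 : \sum_(i < j) (a ^+ i.+1 * b ^+ (j - i.+1)) *+ 'C(2 * j, (2 * i).+1) =
    a * odd_binomial_sum a b j.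
  rewrite /odd_binomial_sum mulr_sumr; apply: eq_bigr => i _.
  rewrite (_ : j - i.+1 = (j.-1 - i))%N; last by have := ltn_ord i; lia.
  by rewrite exprS mulrnAr mulrA.
rewrite mulrDl -e2 -e1 {1}/odd_binomial_sum.
rewrite (addrC (\sum_(i < j) _)) addrA /even_binomial_sum -sumrMnl -big_split/=.
rewrite big_ord_recl [in RHS]big_ord_recl/= !muln0 bin0 !bin1.
rewrite -[RHS]addrA -big_split/=; congr (_ + _).
  by rewrite -mulrnA -mulrnDr; congr (_ *+ _); lia.
apply: eq_bigr => i _; rewrite /bump/= !add1n -!mulrnA -!mulrnDr.
congr (_ *+ _).
rewrite (_ : 2 * j.+1 = (2 * j).+2)%N; last by lia.
rewrite (_ : 2 * i.+1 = (2 * i).+2)%N; last by lia.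
rewrite !binS; lia.
Qed.

(** The recurrences have nonnegative coefficients, in which only a b changes
once a + b is fixed; so both sums grow with a b, by a joint induction. *)
Lemma odd_binomial_sum_le (R : realFieldType) (a b c d : R) j :
  0 <= a -> 0 <= b -> a + b = c + d -> a * b <= c * d ->
  odd_binomial_sum a b j <= odd_binomial_sum c d j.
Proof.
move=> a0 b0 abcd abLcd.
suff : [/\ 0 <= even_binomial_sum a b j <= even_binomial_sum c d j &
           0 <= odd_binomial_sum a b j <= odd_binomial_sum c d j].
  by case=> _ /andP[].
have ab0 : 0 <= a * b by exact: mulr_ge0.
have s0 : 0 <= a + b by exact: addr_ge0.
elim: j => [|j [/andP[e0 eL] /andP[u0 uL]]].
  by rewrite /even_binomial_sum /odd_binomial_sum !big_ord_recl !big_ord0/=; split;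
    rewrite ?lexx ?expr0 ?mul1r ?mulr1n ?addr0 ?ler01 ?lexx.
rewrite !even_binomial_sumS !odd_binomial_sumS -abcd; split.
  apply/andP; split; first by rewrite addr_ge0// ?mulr_ge0// mulrn_wge0// mulr_ge0.
  rewrite lerD// ?ler_wpM2l// lerMn2r/= ler_pM//.
apply/andP; split; first by rewrite addr_ge0// ?mulr_ge0// mulrn_wge0// mulr_ge0.
by rewrite lerD ?lerMn2r//= ler_wpM2l.
Qed.

(** The binomial coefficients of order 2j+2 with odd index add up to 2^(2j+1). *)
Lemma odd_binomial_sum_diag (R : comPzRingType) (a : R) j :
  odd_binomial_sum a a j.+1 = a ^+ j * 2 ^+ (2 * j).+1.
Proof.
suff [] : even_binomial_sum a a j.+1 = a ^+ j.+1 * 2 ^+ (2 * j).+1 /\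
       odd_binomial_sum a a j.+1 = a ^+ j * 2 ^+ (2 * j).+1 by [].
elim: j => [|j [IHe IHo]].
  have -> : even_binomial_sum a a 1 = a + a.
    rewrite /even_binomial_sum !big_ord_recl big_ord0 /bump/= muln0 bin0 binn.
    by rewrite !expr0 mul1r mulr1 addr0.
  have -> : odd_binomial_sum a a 1 = 2.
    by rewrite /odd_binomial_sum big_ord_recl big_ord0 muln0 muln1 bin1 addr0 mulr1.
  by rewrite muln0; split; ring.
rewrite !(even_binomial_sumS _ _ j.+1) !(odd_binomial_sumS _ _ j.+1) IHe IHo.
rewrite (_ : 2 * j.+1 = (2 * j).+2)%N; last by lia.
by rewrite !exprS; split; ring.
Qed.

(** * Truncated series of sinh(sqrt(a) t) / (sqrt(a) t) *)

(** The variable of the polynomial stands for t^2. *)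
Definition sinhc_poly (R : realFieldType) (K : nat) (a : R) : {poly R} :=
  \poly_(j < K.+1) (a ^+ j / ((2 * j).+1)`!%:R).

Lemma sinhc_polyE (R : realFieldType) K (a : R) j : (j <= K)%N ->
  (sinhc_poly K a)`_j = a ^+ j / ((2 * j).+1)`!%:R.
Proof. by move=> jK; rewrite coef_poly ltnS jK. Qed.

Lemma sinhc_poly0 (R : realFieldType) K : sinhc_poly K 0 = 1 :> {poly R}.
Proof.
apply/polyP => j; rewrite coef_poly coef1 expr0n ltnS.
by case: j => [|j] /=; [rewrite divr1|rewrite mul0r if_same].
Qed.

Lemma sinhc_poly_coef_ge0 (R : realFieldType) K (a : R) j : 0 <= a ->
  0 <= (sinhc_poly K a)`_j.
Proof.
move=> a0; rewrite coef_poly; case: ifP => // _.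
by rewrite divr_ge0 ?exprn_ge0// ler0n.
Qed.

Lemma coef_sinhc_polyM (R : realFieldType) K (a b : R) j : (j <= K)%N ->
  (sinhc_poly K a * sinhc_poly K b)`_j =
  odd_binomial_sum a b j.+1 / (2 * j.+1)`!%:R.
Proof.
move=> jK; rewrite coefM /odd_binomial_sum mulr_suml; apply: eq_bigr => i _.
have ij : (i <= j)%N by rewrite -ltnS.
rewrite !sinhc_polyE ?(leq_trans _ jK) ?leq_subr//= -mulr_natr.
have f0 n : n`!%:R != 0 :> R by rewrite pnatr_eq0 -lt0n fact_gt0.
have /(congr1 (fun n => n%:R : R)) : ('C(2 * j.+1, (2 * i).+1) *
    (((2 * i).+1)`! * ((2 * (j - i)).+1)`!) = (2 * j.+1)`!)%N.
  by rewrite -(@bin_fact (2 * j.+1) (2 * i).+1); [congr (_ * (_ * _`!))%N; lia|lia].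
rewrite natrM (natrM _ ((2 * i).+1)`!) => <-.
have c0 : ('C(2 * j.+1, (2 * i).+1)%:R != 0 :> R).
  by rewrite pnatr_eq0 -lt0n bin_gt0; lia.
have := f0 (2 * (j - i)).+1; have := f0 (2 * i).+1; move: c0.
move: ((2 * i).+1)`! ((2 * (j - i)).+1)`! => x y z0 x0 y0.
by field; rewrite x0 y0 z0.
Qed.

(** The lower bound 0 makes this relation compatible with products. *)
Definition coef_le (R : realFieldType) (K : nat) (p q : {poly R}) : Prop :=
  forall j, (j <= K)%N -> 0 <= p`_j <= q`_j.

Lemma coef_leM (R : realFieldType) K (p q r s : {poly R}) :
  coef_le K p q -> coef_le K r s -> coef_le K (p * r) (q * s).
Proof.
move=> pq rs j jK; rewrite !coefM; apply/andP; split.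
  apply: sumr_ge0 => i _; have /andP[p0 _] := pq i (leq_trans (leq_ord i) jK).
  by have /andP[r0 _] := rs _ (leq_trans (leq_subr i j) jK); rewrite mulr_ge0.
apply: ler_sum => i _; have /andP[p0 ?] := pq i (leq_trans (leq_ord i) jK).
by have /andP[r0 ?] := rs _ (leq_trans (leq_subr i j) jK); rewrite ler_pM.
Qed.

Lemma coef_le_trans (R : realFieldType) K (p q r : {poly R}) :
  coef_le K p q -> coef_le K q r -> coef_le K p r.
Proof.
move=> pq qr j jK; have /andP[p0 pq'] := pq j jK; have /andP[_ qr'] := qr j jK.
by rewrite p0 (le_trans pq').
Qed.

Lemma sinhc_poly_coef_le (R : realFieldType) K (a : R) : 0 <= a ->
  coef_le K (sinhc_poly K a) (sinhc_poly K a).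
Proof. by move=> a0 j jK; rewrite lexx sinhc_poly_coef_ge0. Qed.

Lemma sinhc_polyX_coef_le (R : realFieldType) K (a : R) k : 0 <= a ->
  coef_le K (sinhc_poly K a ^+ k) (sinhc_poly K a ^+ k).
Proof.
move=> a0; elim: k => [j jK|k IH]; first by rewrite expr0 coef1 lexx ler0n.
by rewrite exprS; apply: coef_leM => //; exact: sinhc_poly_coef_le.
Qed.

(** Schur concavity: the coefficients of the product of two factors increase when
the two arguments approach each other with a fixed sum, that is, when their
product increases. *)
Lemma sinhc_poly_spread (R : realFieldType) K (a b c d : R) :
  0 <= a -> 0 <= b -> a + b = c + d -> a * b <= c * d ->
  coef_le K (sinhc_poly K a * sinhc_poly K b) (sinhc_poly K c * sinhc_poly K d).
Proof.
move=> a0 b0 abcd abLcd j jK; rewrite !coef_sinhc_polyM//; apply/andP; split.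
  rewrite divr_ge0 ?ler0n//; apply: sumr_ge0 => i _.
  by rewrite mulrn_wge0// mulr_ge0// exprn_ge0.
by rewrite ler_wpM2r ?invr_ge0 ?ler0n// odd_binomial_sum_le.
Qed.

(** Every family in [0, M] is pushed to the extreme family of the same sum, in which
all members but one are 0 or M, by merging one member x at a time with the
remainder r.  If x + r <= M, the pair (x, r) spreads to (0, x + r); otherwise it
spreads to (M, x + r - M), since x r - M (x + r - M) = (M - x)(M - r) >= 0. *)
Lemma sinhc_poly_prod_merge (R : realFieldType) K (M : R) (s : seq R) :
  (forall x, x \in s -> 0 <= x <= M) -> 0 <= M ->
  exists q r, [/\ 0 <= r <= M, \sum_(x <- s) x = M *+ q + r &
    coef_le K (sinhc_poly K M ^+ q * sinhc_poly K r)
              (\prod_(x <- s) sinhc_poly K x)].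
Proof.
move=> + M0; elim: s => [_|x s IH xs].
  exists 0%N, 0; rewrite !big_nil lexx M0 mulr0n addr0; split => //.
  by rewrite expr0 mul1r sinhc_poly0 => j _; rewrite coef1 lexx ler0n.
have /andP[x0 xM] := xs x (mem_head _ _).
have {IH}[y ys|q [r [/andP[r0 rM] sE IH]]] := IH.
  by apply: xs; rewrite in_cons ys orbT.
have step c d : 0 <= c -> 0 <= d -> c + d = x + r -> c * d <= x * r ->
    coef_le K (sinhc_poly K M ^+ q * (sinhc_poly K c * sinhc_poly K d))
      (\prod_(y <- x :: s) sinhc_poly K y).
  move=> c0 d0 cdE cdL; rewrite big_cons.
  apply: (@coef_le_trans _ _ _
    (sinhc_poly K M ^+ q * (sinhc_poly K x * sinhc_poly K r))).
    apply: coef_leM; first exact: sinhc_polyX_coef_le.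
    exact: sinhc_poly_spread.
  by rewrite mulrCA; apply: coef_leM => //; exact: sinhc_poly_coef_le.
have -> : \sum_(y <- x :: s) y = x + (M *+ q + r) by rewrite big_cons sE.
have [xrM|Mxr] := lerP (x + r) M.
  exists q, (x + r); split; first by rewrite addr_ge0.
    by rewrite addrCA.
  have := step 0 (x + r); rewrite sinhc_poly0 mul1r; apply => //.
  - exact: addr_ge0.
  - by rewrite add0r.
  - by rewrite mul0r mulr_ge0.
exists q.+1, (x + r - M); split.
- by apply/andP; split; lra.
- by rewrite mulrSr; ring.
- rewrite exprSr -mulrA; apply: step => //; [lra|ring|nra].
Qed.

(** The sum 2M leaves only the extreme family (M, M, 0, ..., 0), possibly with the
second M in the role of the remainder. *)
Lemma coef_prod_sinhc_poly_ge (R : realFieldType) K (M : R) (s : seq R) :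
  (forall x, x \in s -> 0 <= x <= M) -> \sum_(x <- s) x = M *+ 2 ->
  M ^+ K * 2 ^+ (2 * K).+1 / (2 * K.+1)`!%:R <= (\prod_(x <- s) sinhc_poly K x)`_K.
Proof.
move=> sM sE.
have M0 : 0 <= M.
  have : 0 <= \sum_(x <- s) x.
    by rewrite big_seq; apply: sumr_ge0 => x /sM/andP[].
  by rewrite sE pmulrn_lge0.
have [q [r [/andP[r0 rM] srE /(_ K (leqnn _)) /andP[_]]]] :=
  sinhc_poly_prod_merge K sM M0.
apply: le_trans; rewrite -odd_binomial_sum_diag -(coef_sinhc_polyM _ _ (leqnn K)).
move: srE; rewrite sE => srE.
have [M00|Mn0] := eqVneq M 0.
  have -> : r = 0 by apply/eqP; rewrite eq_le r0 -{1}M00 rM.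
  by rewrite M00 sinhc_poly0 expr1n.
have Mgt0 : 0 < M by rewrite lt_def Mn0.
case: q srE => [|[|[|q]]].
- by rewrite mulr0n add0r mulr2n => rE; exfalso; lra.
- by rewrite mulr1n mulr2n => /addrI <-; rewrite expr1.
- by rewrite -[LHS]addr0 => /addrI <-; rewrite sinhc_poly0 mulr1.
- move=> /eqP; rewrite -subr_eq0 => /eqP h; exfalso.
  have : 0 <= M *+ q by rewrite mulrn_wge0.
  by move: h; rewrite !mulrS mulr0n; lra.
Qed.

Lemma coef_prod_sinhc_poly_eq (R : realFieldType) K (M : R) (s : seq R) :
  (forall x, x \in s -> x = 0 \/ x = M) -> \sum_(x <- s) x = M *+ 2 ->
  (\prod_(x <- s) sinhc_poly K x)`_K = M ^+ K * 2 ^+ (2 * K).+1 / (2 * K.+1)`!%:R.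
Proof.
move=> s0M sE.
have [c [cE ->]] : exists c, \sum_(x <- s) x = M *+ c /\
    \prod_(x <- s) sinhc_poly K x = sinhc_poly K M ^+ c.
  elim: s s0M {sE} => [_|x s IH xs]; first by exists 0%N; rewrite !big_nil.
  have [y ys|c [cE pE]] := IH; first by apply: xs; rewrite in_cons ys orbT.
  have [->|->] := xs x (mem_head _ _).
    by exists c; rewrite !big_cons cE pE sinhc_poly0 add0r mul1r.
  by exists c.+1; rewrite !big_cons cE pE mulrS exprS.
rewrite -odd_binomial_sum_diag -(coef_sinhc_polyM _ _ (leqnn K)).
have [->|Mn0] := eqVneq M 0; first by rewrite sinhc_poly0 expr1n mul1r.
suff -> : c = 2%N by rewrite expr2.
have := cE; rewrite sE -mulr_natr -[RHS]mulr_natr => /(mulfI Mn0)/eqP.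
by rewrite eqr_nat => /eqP.
Qed.

(** * Eigenvalues of the adjacency matrix *)

(** det(X^2 - A^2) = det(X - A) det(X + A), and det(X + A) is, up to sign, the
characteristic polynomial at -X; the square substitution is then cancelled. *)
Lemma char_poly_mulmx_self (F : fieldType) n (A : 'M[F]_n) (l : 'I_n -> F) :
  char_poly A = \prod_(i < n) ('X - (l i)%:P) ->
  char_poly (A *m A) = \prod_(i < n) ('X - (l i ^+ 2)%:P).
Proof.
move=> Al; pose B : 'M[{poly F}]_n := map_mx polyC A.
have plusE : \det ('X%:M + B) = \prod_(i < n) ('X + (l i)%:P).
  have : (char_poly A \Po (- 'X)) = (-1) ^+ n * \det ('X%:M + B).
    rewrite /char_poly -det_map_mx -detZ; congr (\det _).
    apply/matrixP => i j; rewrite !mxE/=.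
    rewrite comp_polyB comp_polyC raddfMn/= comp_polyX.
    by rewrite mulN1r mulNrn opprD.
  rewrite Al rmorph_prod/= => h; apply: (@mulfI _ ((-1) ^+ n)).
    by rewrite expf_neq0// oppr_eq0 oner_eq0.
  rewrite -h; under eq_bigr do rewrite comp_polyB comp_polyC comp_polyX -opprD.
  by rewrite prodrN card_ord.
have sqE : char_poly (A *m A) \Po 'X^2 =
    \prod_(i < n) ('X - (l i ^+ 2)%:P) \Po 'X^2.
  rewrite rmorph_prod/=.
  under [RHS]eq_bigr do
    rewrite comp_polyB comp_polyC comp_polyX rmorphXn/= subr_sqr.
  rewrite big_split/= -Al -plusE /char_poly -det_mulmx -det_map_mx.
  congr (\det _); rewrite /char_poly_mx map_mxB map_scalar_mx/= comp_polyX.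
  rewrite mulmxDr !mulmxBl -!/B -scalar_mxM -expr2 -scalar_mxC addrA subrK.
  congr (_ - _).
  apply/matrixP => i j; rewrite !mxE comp_polyC rmorph_sum.
  by apply: eq_bigr => k _; rewrite !mxE rmorphM.
apply/polyP => i; have /(congr1 (fun p : {poly F} => p`_(i * 2))) := sqE.
by rewrite !coef_comp_poly_Xn// dvdn_mull// mulnK.
Qed.

(** The trace of A^2 is read off the subleading coefficient of its characteristic
polynomial. *)
Lemma sum_sqr_char_poly_roots (F : fieldType) n (A : 'M[F]_n) (l : 'I_n -> F) :
  char_poly A = \prod_(i < n) ('X - (l i)%:P) ->
  \sum_(i < n) l i ^+ 2 = \tr (A *m A).
Proof.
case: n A l => [|n] A l Al; first by rewrite /mxtrace !big_ord0.
apply: oppr_inj; rewrite -char_poly_trace// (char_poly_mulmx_self Al).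
pose s := [seq l i ^+ 2 | i <- enum 'I_n.+1].
have sz : size s = n.+1 by rewrite size_map size_enum_ord.
have -> : \prod_(i < n.+1) ('X - (l i ^+ 2)%:P) = \prod_(x <- s) ('X - x%:P).
  by rewrite big_map big_enum.
by have := @coefPn_prod_XsubC _ s; rewrite sz => ->//; rewrite big_map big_enum.
Qed.

Section GraphSpectrum.
Context (R : realType) (n : nat) (G : sgraph n).

Local Notation A x y := ((G x y)%:R : R).

Lemma handshake : \sum_x \sum_y A x y = (num_edges G)%:R *+ 2.
Proof.
have mE : \sum_(x < n) \sum_(y < n | (x < y)%N) A x y = (num_edges G)%:R.
  rewrite pair_big_dep/= /num_edges -sum1_card natr_sum.
  under [RHS]eq_bigl do rewrite inE.
  by rewrite [RHS]big_mkcondr; apply: eq_bigr => p _; case: (G _ _).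
have mE' : \sum_(x < n) \sum_(y < n | (y < x)%N) A x y = (num_edges G)%:R.
  rewrite (exchange_big_dep predT)//= -mE; apply: eq_bigr => x _.
  by apply: eq_bigr => y _; rewrite adj_sym.
rewrite mulr2n -{1}mE -mE' -big_split; apply: eq_bigr => x _ /=.
rewrite (bigID (fun y : 'I_n => (x < y)%N))/=; congr (_ + _).
rewrite (bigD1 x) ?ltnn//= adj_irr add0r; apply: eq_bigl => y.
by rewrite -leqNgt ltn_neqAle andbC.
Qed.

Lemma sum_sqr_eigenvalues :
  \sum_i eigenvalues_mx (adjmx R G) 0 i ^+ 2 = (num_edges G)%:R *+ 2.
Proof.
rewrite (sum_sqr_char_poly_roots (eigenvalues_mxP (adjmx_sym R G))) -handshake.
apply: eq_bigr => x _; rewrite mxE; apply: eq_bigr => y _.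
by rewrite !mxE (adj_sym G y) -natrM mulnb andbb.
Qed.

Lemma eigenvector_of_eigenvalue i :
  exists2 v : 'I_n -> R, (exists x, v x != 0) &
    forall x, eigenvalues_mx (adjmx R G) 0 i * v x = \sum_y A x y * v y.
Proof.
have /eigenvalueP[v vA v0] : eigenvalue (adjmx R G) (eigenvalues_mx (adjmx R G) 0 i).
  rewrite eigenvalue_root_char (eigenvalues_mxP (adjmx_sym R G)) /root.
  by rewrite horner_prod (bigD1 i)//= !hornerE subrr mul0r.
exists (fun x => v 0 x).
  apply/existsP; apply: contraNT v0 => /existsPn v0.
  by apply/eqP/rowP => x; rewrite mxE; apply/eqP; have := v0 x; rewrite negbK.
move=> x; have /rowP/(_ x) := vA; rewrite !mxE => <-.
by apply: eq_bigr => y _; rewrite !mxE mulrC adj_sym.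
Qed.

End GraphSpectrum.

(** * Counting walks of length two *)

Section LocalCounting.
Context (R : realType) (n : nat) (G : sgraph n) (v : 'I_n).

Local Notation A x y := ((G x y)%:R : R).

(** The vertices fall into v itself, its neighbours, and the others, called far.
All counts below are sums over ordered pairs of vertices. *)
Definition far (x : 'I_n) := (x != v) && ~~ G v x.

Definition codegree (w : 'I_n) : R := \sum_(u | G v u) A u w.

Lemma sum_by_distance (f : 'I_n -> R) :
  \sum_x f x = f v + \sum_(x | G v x) f x + \sum_(x | far x) f x.
Proof.
rewrite (bigD1 v)//= -addrA; congr (_ + _).
rewrite (bigID (fun x => G v x))/=; congr (_ + _); apply: eq_bigl => x.
by have [->|//] := eqVneq x v; rewrite adj_irr.
Qed.

(** The sum of the codegrees over the neighbours of v is twice the number of edges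
between neighbours of v; over the far vertices, it is the number of edges from a
neighbour to a far vertex. *)
Definition near_edges : R := \sum_(x | G v x) codegree x.
Definition cross_edges : R := \sum_(x | far x) codegree x.
Definition far_edges : R := \sum_(x | far x) \sum_(y | far y) A x y.

Lemma codegree_self : codegree v = \sum_(u | G v u) 1.
Proof. by apply: eq_bigr => u; rewrite adj_sym => ->. Qed.

Lemma codegree_ge0 w : 0 <= codegree w.
Proof. by apply: sumr_ge0 => u _; rewrite ler0n. Qed.

Lemma near_edgesE : near_edges = \sum_(x | G v x) \sum_(y | G v y) A x y.
Proof. by apply: eq_bigr => x _; apply: eq_bigr => y _; rewrite adj_sym. Qed.

Lemma cross_edgesE : cross_edges = \sum_(x | far x) \sum_(y | G v y) A x y.
Proof. by apply: eq_bigr => x _; apply: eq_bigr => y _; rewrite adj_sym. Qed.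

(** Edges at v, between neighbours of v, between a neighbour and a far vertex, and
between far vertices.  Within one class each edge is counted twice by the sum
over ordered pairs. *)
Lemma edge_count_by_distance :
  (num_edges G)%:R *+ 2 =
  codegree v *+ 2 + near_edges + cross_edges *+ 2 + far_edges.
Proof.
have rowE x : \sum_y A x y = A x v + \sum_(y | G v y) A x y + \sum_(y | far y) A x y.
  exact: sum_by_distance.
have far0 x : far x -> A x v = 0.
  by case/andP => _; rewrite adj_sym => /negbTE ->.
have near1 x : G v x -> A x v = 1 by rewrite adj_sym => ->.
rewrite -handshake sum_by_distance rowE adj_irr add0r.
rewrite (eq_bigr _ (fun x _ => rowE x)).
rewrite [X in _ + X = _](eq_bigr _ (fun x _ => rowE x)).
rewrite !big_split/= -near_edgesE -cross_edgesE.
rewrite (eq_bigr _ near1) -codegree_self [\sum_(i | far i) A i v]big1//.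
rewrite [\sum_(y | far y) A v y]big1 => [|x /far0]; last by rewrite adj_sym.
have -> : \sum_(y | G v y) A v y = codegree v.
  by rewrite codegree_self; apply: eq_bigr => y ->.
have -> : \sum_(i | G v i) \sum_(y | far y) A i y = cross_edges.
  by rewrite exchange_big.
rewrite -/far_edges; ring.
Qed.

Section SubinvariantVector.
Context (mu : R) (y : 'I_n -> R) (mu0 : 0 <= mu)
  (y01 : forall x, 0 <= y x <= 1) (yv : y v = 1)
  (muy : forall x, mu * y x <= \sum_u A x u * y u).

Let y0 x : 0 <= y x. Proof. by case/andP: (y01 x). Qed.
Let y1 x : y x <= 1. Proof. by case/andP: (y01 x). Qed.

(** mu^2 y <= A^2 y, read at v, where y is 1 and where A^2 lists the codegrees. *)
Lemma subinvariant_sqr_le :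
  mu ^+ 2 <= codegree v + \sum_(w | G v w) codegree w * y w
                        + \sum_(w | far w) codegree w * y w.
Proof.
have -> : codegree v = codegree v * y v by rewrite yv mulr1.
rewrite -sum_by_distance.
have -> : \sum_x codegree x * y x = \sum_u A v u * \sum_w A u w * y w.
  under eq_bigr do rewrite mulr_suml.
  rewrite exchange_big/= big_mkcond; apply: eq_bigr => u _.
  by case: (G v u); rewrite ?mul1r ?mul0r.
rewrite expr2 (le_trans (y := mu * \sum_u A v u * y u))//.
  by rewrite ler_wpM2l// (le_trans _ (muy v))// yv mulr1.
rewrite mulr_sumr; apply: ler_sum => u _.
by rewrite mulrCA ler_wpM2l ?ler0n.
Qed.

(** The neighbours of v are pairwise non-adjacent, so a walk of length two from v
either returns to v, once for each edge at v, or ends with an edge from a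
neighbour to a far vertex; each edge accounts for at most one such walk. *)
Lemma triangle_free_sqr_le : triangle_free G -> mu ^+ 2 <= (num_edges G)%:R.
Proof.
move=> tf; have near0 w : G v w -> codegree w = 0.
  move=> vw; apply: big1 => u vu; case: (boolP (G u w)) => // uw.
  exfalso; apply: tf; exists [tuple v; u; w].
  apply/andP; split; first by rewrite /= vu uw adj_sym vw.
  rewrite /= !inE !negb_or !andbT.
  by apply/andP; split; [apply/andP; split|]; apply/negP => /eqP h;
    [move: vu|move: vw|move: uw]; rewrite h adj_irr.
have e0 : near_edges = 0 by apply: big1.
have := subinvariant_sqr_le; rewrite [X in _ + X + _]big1; last first.
  by move=> w /near0 ->; rewrite mul0r.
have := edge_count_by_distance; rewrite e0.
have : \sum_(w | far w) codegree w * y w <= cross_edges.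
  by apply: ler_sum => w _; rewrite ler_piMr ?codegree_ge0.
have : 0 <= far_edges.
  by apply: sumr_ge0 => x _; apply: sumr_ge0 => u _; rewrite ler0n.
rewrite !mulr2n; lra.
Qed.

(** Two common neighbours of v and w close a 4-cycle with them. *)
Lemma square_free_codegree_le1 w : square_free G -> w != v -> codegree w <= 1.
Proof.
move=> sf wv.
have -> : codegree w = #|[pred u | G v u && G u w]|%:R.
  rewrite -sum1_card natr_sum (eq_bigl (fun u => G v u && G u w))//.
  by rewrite big_mkcondr; apply: eq_bigr => u _; case: (G u w).
rewrite lern1; apply/card_le1_eqP => a b.
rewrite !inE => /andP[va aw] /andP[vb bw]; apply: contrapT => /eqP ab; apply: sf.
exists [tuple v; a; w; b]; apply/andP; split.
  by rewrite /= va aw (adj_sym G w) bw (adj_sym G b) vb.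
rewrite /= !inE !negb_or !andbT eq_sym in ab *.
have irr x z : G x z -> x != z by apply: contraTneq => ->; rewrite adj_irr.
rewrite (irr _ _ va) (eq_sym v w) wv (irr _ _ vb) (irr _ _ aw) ab.
by rewrite eq_sym (irr _ _ bw).
Qed.

(** Let S and E be the sums of codegree times y over the neighbours of v and over
the far vertices, d the degree of v, and e1, e2, e3 the numbers of edges between
neighbours, across, and between far vertices.  Away from v all codegrees are at
most 1, so mu y <= A y, weighted by the codegree and summed over either class,
gives mu S <= 2 e1 + S + E and mu E <= e2 + 2 e3.  If mu >= 3, then S <= e1 + E / 2 and
E <= (e2 + 2 e3) / 3, so mu^2 <= d + S + E <= d + e1 + e2 / 2 + e3 <= m. *)
Lemma square_free_sqr_le : square_free G -> (9 <= num_edges G)%N ->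
  mu ^+ 2 <= (num_edges G)%:R.
Proof.
move=> sf m9; have m9R : 9 <= (num_edges G)%:R :> R by rewrite ler_nat.
(* If mu <= 3, then mu^2 <= 9 <= m. *)
have [mu3|mu3] := lerP mu 3.
  by rewrite (le_trans _ m9R)// expr2 (_ : 9 = 3 * 3) ?ler_pM//; ring.
have c1 w : w != v -> codegree w <= 1 by exact: square_free_codegree_le1.
have nearc1 w : G v w -> codegree w <= 1.
  by move=> vw; apply: c1; apply: contraTneq vw => ->; rewrite adj_irr.
have farc1 w : far w -> codegree w <= 1 by case/andP => /c1.
have mulA x : mu * y x <= A x v + \sum_(u | G v u) A x u * y u
                                + \sum_(u | far u) A x u * y u.
  by apply: le_trans (muy x) _; rewrite sum_by_distance yv mulr1.
pose S := \sum_(w | G v w) codegree w * y w.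
pose E := \sum_(w | far w) codegree w * y w.
have A0 x u : 0 <= A x u by rewrite ler0n.
have S0 : 0 <= S by apply: sumr_ge0 => w _; rewrite mulr_ge0 ?codegree_ge0.
have muS : mu * S <= near_edges + S + E.
  have -> : S = \sum_(w | G v w) \sum_(u | G v u) A w u * y u.
    by rewrite exchange_big/=; apply: eq_bigr => u _; rewrite -mulr_suml.
  have -> : E = \sum_(w | G v w) \sum_(u | far u) A w u * y u.
    by rewrite exchange_big/=; apply: eq_bigr => u _; rewrite -mulr_suml.
  rewrite -!big_split/=.
  have -> : \sum_(w | G v w) \sum_(u | G v u) A w u * y u = S.
    by rewrite exchange_big/=; apply: eq_bigr => u _; rewrite -mulr_suml.
  rewrite mulr_sumr; apply: ler_sum => w vw; rewrite mulrCA.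
  rewrite (le_trans (ler_wpM2l (codegree_ge0 w) (mulA w)))//.
  rewrite adj_sym vw !mulrDr mulr1 !lerD// ler_piMl ?nearc1//.
    by apply: sumr_ge0 => u _; rewrite mulr_ge0.
  by apply: sumr_ge0 => u _; rewrite mulr_ge0.
have muE : mu * E <= cross_edges + far_edges.
  rewrite -big_split mulr_sumr/=; apply: ler_sum => w fw; rewrite mulrCA.
  rewrite (le_trans (ler_wpM2l (codegree_ge0 w) (mulA w)))//.
  have -> : A w v = 0 by case/andP: fw => _; rewrite adj_sym => /negbTE ->.
  rewrite add0r mulrDr lerD//.
    rewrite ler_piMr ?codegree_ge0// (le_trans _ (farc1 w fw))//.
    by apply: ler_sum => u _; rewrite adj_sym ler_piMr.
  rewrite (@le_trans _ _ (\sum_(u | far u) A w u * y u))//.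
    rewrite ler_piMl ?farc1//; apply: sumr_ge0 => u _; exact: mulr_ge0.
  by apply: ler_sum => u _; rewrite ler_piMr.
have E0 : 0 <= E by apply: sumr_ge0 => w _; rewrite mulr_ge0 ?codegree_ge0.
have := subinvariant_sqr_le; rewrite -/S -/E.
have := edge_count_by_distance; rewrite !mulr2n.
have : 0 <= (mu - 3) * S by rewrite mulr_ge0// subr_ge0 ltW.
have : 0 <= (mu - 3) * E by rewrite mulr_ge0// subr_ge0 ltW.
rewrite !mulrBl.
have C0 : 0 <= cross_edges by apply: sumr_ge0 => x _; exact: codegree_ge0.
lra.
Qed.

End SubinvariantVector.
End LocalCounting.

(** The modulus of an eigenvector, divided by its largest entry, satisfies
mu y <= A y by the triangle inequality. *)
Lemma eigenvalue_sqr_le (R : realType) n (G : sgraph n) i :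
  triangle_free G \/ square_free G /\ (9 <= num_edges G)%N ->
  eigenvalues_mx (adjmx R G) 0 i ^+ 2 <= (num_edges G)%:R.
Proof.
move=> hG; have [x [x0 xP] lx] := eigenvector_of_eigenvalue R G i.
set l := eigenvalues_mx _ _ _ in lx *.
pose v := [arg max_(w > x0) `|x w|]%O.
have vmax w : `|x w| <= `|x v| by rewrite /v; case: arg_maxP => //= j _ ->.
have xv0 : 0 < `|x v| by rewrite (lt_le_trans _ (vmax x0))// normr_gt0.
pose y w := `|x w| / `|x v|.
have y01 w : 0 <= y w <= 1.
  by rewrite /y divr_ge0 ?normr_ge0//= ler_pdivrMr// mul1r vmax.
have yv : y v = 1 by rewrite /y divff// gt_eqF.
have muy w : `|l| * y w <= \sum_u (G w u)%:R * y u.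
  rewrite /y mulrA -normrM lx; under [leRHS]eq_bigr do rewrite mulrA.
  rewrite -mulr_suml ler_wpM2r ?invr_ge0 ?normr_ge0//.
  rewrite (le_trans (ler_norm_sum _ _ _))//; apply: ler_sum => u _.
  by rewrite normrM ger0_norm ?ler0n.
rewrite -real_normK ?num_real//.
case: hG => [tf|[sf m9]].
  exact: (triangle_free_sqr_le (normr_ge0 l) y01 yv muy tf).
exact: (square_free_sqr_le (normr_ge0 l) y01 yv muy sf m9).
Qed.

(** * Complete bipartite graphs and stars *)

Lemma cut_graph_triangle_free n (G : sgraph n) (A : {set 'I_n}) :
  (forall x y, G x y = ((x \in A) != (y \in A))) -> triangle_free G.
Proof.
move=> GA [[[|x [|y [|z [|]]]]] //= _] /andP[+ _].
by rewrite /= !GA; case: (x \in A); case: (y \in A); case: (z \in A).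
Qed.

Lemma star_square_free n (G : sgraph n) : is_star G -> square_free G.
Proof.
move=> [c Gc] [[[|x [|y [|z [|t [|]]]]]] //= _] /andP[+ +].
rewrite /= !Gc !inE !negb_or -!andbA => /and5P[xy yz zt _ _] /and4P[_ xz _].
move=> /and3P[_ yt _].
(* The centre lies on every edge, so two opposite vertices of the cycle both
   equal it. *)
have [xc|xc] := boolP (x == c).
  have zc : z == c by move: xy yz; rewrite xc; case: (y == c); case: (z == c).
  by move: xz; rewrite (eqP xc) (eqP zc) eqxx.
have yc : y == c by move: xy; rewrite (negbTE xc); case: (y == c).
have tc : t == c by move: yz zt; rewrite yc; case: (z == c); case: (t == c).
by move: yt; rewrite (eqP yc) (eqP tc) eqxx.
Qed.

(** An eigenvector is determined by its sums s(true) and s(false) over the two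
sides, and l s(b) = k(b) s(~~ b), where k(b) is the size of the side b.  Hence
l^2 s(b) = m s(b), and if l is not 0, one of the two sums is not 0. *)
Lemma cut_graph_sqr_eigenvalue (R : realType) n (G : sgraph n) (A : {set 'I_n}) i :
  (forall x y, G x y = ((x \in A) != (y \in A))) ->
  eigenvalues_mx (adjmx R G) 0 i ^+ 2 = 0 \/
  eigenvalues_mx (adjmx R G) 0 i ^+ 2 = (num_edges G)%:R.
Proof.
move=> GA; have [v [x0 vx0] lv] := eigenvector_of_eigenvalue R G i.
set l := eigenvalues_mx _ _ _ in lv *.
pose s (b : bool) := \sum_(x | (x \in A) == b) v x.
pose k (b : bool) : R := \sum_(x | (x \in A) == b) 1.
have rowE (f : 'I_n -> R) x : \sum_y (G x y)%:R * f y =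
    \sum_(y | (y \in A) == ~~ (x \in A)) f y.
  rewrite [RHS]big_mkcond; apply: eq_bigr => y _; rewrite GA.
  by case: (x \in A); case: (y \in A); rewrite /= ?mul1r ?mul0r.
have lE x : l * v x = s (~~ (x \in A)) by rewrite lv rowE.
have ls b : l * s b = k b * s (~~ b).
  by rewrite mulr_sumr mulr_suml; apply: eq_bigr => x /eqP <-; rewrite lE mul1r.
have mE : (num_edges G)%:R = k true * k false :> R.
  have : (num_edges G)%:R *+ 2 = (k true * k false) *+ 2 :> R.
    rewrite -handshake (bigID (fun x => x \in A))/= mulr2n; congr (_ + _).
      rewrite mulr_suml; apply: eq_big => [x|x xA]; first by case: (x \in A).
      under eq_bigr do rewrite -[_%:R]mulr1.
      by rewrite rowE xA mul1r.
    rewrite mulrC mulr_suml; apply: eq_big => [x|x /negbTE xA]; first by case: (x \in A).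
    under eq_bigr do rewrite -[_%:R]mulr1.
    by rewrite rowE xA mul1r.
  by move/eqP; rewrite eqrMn2r// => /eqP.
have l2s b : l ^+ 2 * s b = (num_edges G)%:R * s b.
  rewrite expr2 -mulrA ls mulrCA ls negbK mulrA mE.
  by case: b => //=; rewrite (mulrC (k false)).
have [l0|l0] := eqVneq l 0; first by left; rewrite l0 expr0n.
right; apply: (mulIf (x := s (~~ (x0 \in A)))); last exact: l2s.
by rewrite -lE mulf_neq0.
Qed.

(** * Expansion of powers of a sum *)

Lemma coef_prod_poly (R : comNzRingType) (n d : nat) (E : 'I_n -> nat -> R) :
  (\prod_(i < n) \poly_(k < d.+1) E i k)`_d =
  \sum_(f : {ffun 'I_n -> 'I_d.+1} | (\sum_i f i == d)%N) \prod_i E i (f i).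
Proof.
under eq_bigr do rewrite poly_def.
rewrite bigA_distr_bigA/= coef_sum [RHS]big_mkcond/=; apply: eq_bigr => f _.
have -> : \prod_i (E i (f i) *: 'X^(f i)) = (\prod_i E i (f i)) *: 'X^(\sum_i f i)%N.
  by rewrite scaler_prod; congr (_ *: _); rewrite prodrXr.
rewrite coefZ coefXn eq_sym; case: eqP => _; by rewrite ?mulr1 ?mulr0.
Qed.

(** This is exp(y_1 t) ... exp(y_n t) = exp((y_1 + ... + y_n) t), truncated at
degree d. *)
Lemma coef_prod_exp_poly (R : realFieldType) (I : Type) (s : seq I) (y : I -> R) d j :
  (j <= d)%N ->
  (\prod_(i <- s) \poly_(k < d.+1) (y i ^+ k / k`!%:R))`_j =
  (\sum_(i <- s) y i) ^+ j / j`!%:R.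
Proof.
have f0 n : n`!%:R != 0 :> R by rewrite pnatr_eq0 -lt0n fact_gt0.
elim: s j => [|i s IH] j jd.
  by rewrite !big_nil coef1 expr0n; case: j jd => [|j] jd; rewrite /= ?mul0r// divr1.
rewrite !big_cons coefM addrC exprDn mulr_suml; apply: eq_bigr => k _.
have kj : (k <= j)%N by rewrite -ltnS.
rewrite coef_poly ltnS (leq_trans kj jd) IH ?(leq_trans (leq_subr _ _))//.
have /(congr1 (fun n => n%:R : R)) := bin_fact kj.
rewrite natrM (natrM _ k`!) => <-.
have c0 : ('C(j, k)%:R != 0 :> R) by rewrite pnatr_eq0 -lt0n bin_gt0.
have := f0 k; have := f0 (j - k)%N; rewrite -[_ *+ 'C(j, k)]mulr_natr.
move: k`! (j - k)`! => a b a0 b0.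
by field; rewrite a0 b0 c0.
Qed.

(** The factor that multiplies l^k / k! is the k-th moment of the uniform law on
[-1, 1], so the right-hand side is the truncated moment generating function of
l X. *)
Lemma sinhc_poly_comp_sqr (R : realFieldType) K (l : R) :
  sinhc_poly K (l ^+ 2) \Po 'X^2 =
  \poly_(k < (2 * K).+1) (l ^+ k / k`!%:R * (if odd k then 0 else k.+1%:R^-1)).
Proof.
apply/polyP => k; rewrite coef_comp_poly_Xn// !coef_poly dvdn2.
case: (boolP (odd k)) => [_|ek]; first by rewrite mulr0 if_same.
have kE : k = (2 * (k %/ 2))%N by rewrite mulnC divnK// dvdn2.
rewrite [in RHS]kE; move: (k %/ 2)%N => j.
rewrite !ltnS leq_pmul2l//; case: ifP => // _.
by rewrite exprM factS natrM invfM mulrCA mulrC.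
Qed.

(** * The Gamma function at integers *)

Import numFieldNormedType.Exports HBNNSimple.
Local Open Scope classical_set_scope.
Local Open Scope ring_scope.

Lemma cvg_exprn_expRN (R : realType) n :
  (x ^+ n * expR (- x) : R) @[x --> +oo%R] --> (0 : R).
Proof.
apply/cvgrPdist_le => e e0; near=> x.
have x0 : 0 < x by near: x; exact: nbhs_pinfty_gt.
rewrite sub0r normrN ger0_norm; last by rewrite mulr_ge0 ?exprn_ge0 ?expR_ge0 ?ltW.
rewrite expRN ler_pdivrMr ?expR_gt0//.
(* x^(n+1) / (n+1)! <= exp x leaves a factor x to beat (n+1)! / e. *)
have h := expR_ge1Dxn n (ltW x0).
apply: (@le_trans _ _ (e * (x ^+ n.+1 / n.+1`!%:R))); last first.
  by rewrite ler_pM2l// (le_trans _ h)// lerDr.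
rewrite exprS mulrA mulrA mulrAC ler_peMl ?exprn_ge0 ?ltW//.
rewrite ltr_pdivlMr ?ltr0n ?fact_gt0// mul1r -ltr_pdivrMl//.
by near: x; apply: nbhs_pinfty_gt; rewrite num_real.
Unshelve. all: by end_near. Qed.

(** A primitive of t^n exp(-t), built by repeated integration by parts. *)
Fixpoint gamma_primitive (R : realType) (n : nat) (t : R) : R :=
  if n is n'.+1 then n%:R * gamma_primitive n' t - t ^+ n * expR (- t)
  else - expR (- t).

Lemma is_derive_gamma_primitive (R : realType) n (t : R) :
  is_derive t 1 (@gamma_primitive R n) (t ^+ n * expR (- t)).
Proof.
have dexpN : is_derive t 1 (fun t : R => expR (- t)) (- expR (- t)).
  have dN : is_derive t 1 (fun t : R => - t) (- 1) by exact: is_deriveN.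
  by have := is_derive1_comp (is_derive_expR (- t)) dN; rewrite mulrN1.
elim: n => [|n IH].
  by apply: is_derive_eq; rewrite opprK mul1r.
have dX : is_derive t 1 (fun t : R => t ^+ n.+1) (n.+1%:R * t ^+ n).
  rewrite (_ : (fun t => _) = id ^+ n.+1); last first.
    by apply/funext => x; rewrite exprfctE.
  by apply: is_derive_eq; rewrite /GRing.scale/= mulr1.
apply: (@is_derive_eq _ _ _ _ _ _ _ _
  (is_deriveB (is_deriveZ n.+1%:R IH) (is_deriveM dX dexpN))).
rewrite /= /GRing.scale/= exprS; ring.
Qed.

Lemma gamma_primitive0 (R : realType) n : gamma_primitive n 0 = - n`!%:R :> R.
Proof.
elim: n => [|n IH] /=; first by rewrite oppr0 expR0.
by rewrite IH expr0n mul0r subr0 factS natrM mulrN.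
Qed.

Lemma gamma_primitive_cvgy (R : realType) n :
  @gamma_primitive R n x @[x --> +oo%R] --> (0 : R).
Proof.
elim: n => [|n IH].
  by rewrite -oppr0; apply: cvgN; exact: cvgr_expR.
rewrite -[0](subr0) -{1}[0](mulr0 n.+1%:R); apply: cvgB.
  by apply: cvgMr.
exact: cvg_exprn_expRN.
Qed.

Lemma Gamma_fact (R : realType) n : Gamma (n%:R + 1) = n`!%:R :> R.
Proof.
have cf (x : R) : {for x, continuous (fun t : R => t ^+ n * expR (- t))}.
  apply: continuousM; first exact: exprn_continuous.
  apply: continuous_comp; last exact: continuous_expR.
  exact: opp_continuous.
transitivity (\int[@lebesgue_measure R]_(t in `]0%R, +oo[) (t ^+ n * expR (- t)))%R.
  apply: eq_Rintegral => t; rewrite inE/= in_itv/= andbT => t0.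
  by rewrite addrK powR_mulrn// ltW.
rewrite /Rintegral integral_itv_obnd_cbnd; last first.
  apply/measurable_EFinP; apply: measurable_funTS.
  by apply: continuous_measurable_fun => x; exact: cf.
rewrite -/(Rintegral _ _ _).
rewrite (@Rintegral_ge0_continuous_FTC2y _ _ (@gamma_primitive R n) _ 0).
- by rewrite gamma_primitive0 sub0r opprK.
- by move=> x x0; rewrite mulr_ge0 ?exprn_ge0 ?expR_ge0.
- by apply: continuous_subspaceT => x; exact: cf.
- exact: gamma_primitive_cvgy.
- by move=> x _; apply: ex_derive; exact: is_derive_gamma_primitive.
- apply: cvg_at_right_filter; apply: differentiable_continuous.
  by apply/derivable1_diffP/ex_derive; exact: is_derive_gamma_primitive.
- move=> x _; rewrite derive1E.
  exact: (@derive_val _ _ _ _ _ _ _ (is_derive_gamma_primitive n x)).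
Qed.

(** * Moments of the uniform law *)

Section UniformMoments.
Context (R : realType) (disp : measure_display) (T : measurableType disp)
  (P : probability T R) (X : {RV P >-> R})
  (lawX : forall B : set R, measurable B -> distribution P X B = uniformN11 R B).

Local Notation mu := (@lebesgue_measure R).

(** The variable is first retyped as a map into [measurableTypeR R], because the
uniform law lives on that copy of the measurable space of reals. *)
Lemma ge0_integral_uniform_law (f : R -> \bar R) :
  measurable_fun setT f -> (forall x, 0 <= f x)%E ->
  (\int[P]_t f (X t) = (2^-1)%:E * \int[mu]_(x in `[(-1)%R, 1%R]) f x)%E.
Proof.
move=> mf f0.
have mX : measurable_fun setT (X : T -> measurableTypeR R).
  exact: (@measurable_funPT _ _ _ _ X).
pose Y : {mfun T >-> measurableTypeR R} :=
  HB.pack (X : T -> measurableTypeR R) (isMeasurableFun.Build _ _ _ _ _ mX).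
have lawY A : measurable A -> A `<=` setT -> distribution P Y A = uniformN11 R A.
  by move=> mA _; exact: lawX.
rewrite -[LHS](@ge0_integral_distribution _ _ _ _ _ P Y f mf f0).
rewrite (@eq_measure_integral _ (measurableTypeR R) R setT _ (distribution P Y) f lawY).
by rewrite integral_uniform// (_ : 1 - -1 = 2)//; ring.
Qed.

Lemma integral_uniform_law (f : R -> R) :
  measurable_fun setT f -> mu.-integrable `[(-1)%R, 1%R] (EFin \o f) ->
  (\int[P]_t (f (X t))%:E = (2^-1)%:E * \int[mu]_(x in `[(-1)%R, 1%R]) (f x)%:E)%E.
Proof.
move=> mf intf.
have mEf : measurable_fun setT (EFin \o f) by exact/measurable_EFinP.
rewrite integralE [in RHS]integralE.
have posE : (\int[P]_t ((fun t => (f (X t))%:E)^\+ t) =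
    (2^-1)%:E * \int[mu]_(x in `[(-1)%R, 1%R]) (EFin \o f)^\+ x)%E.
  rewrite -ge0_integral_uniform_law//; last exact: measurable_funepos.
  by apply: eq_integral => t _; rewrite !funeposE.
have negE : (\int[P]_t ((fun t => (f (X t))%:E)^\- t) =
    (2^-1)%:E * \int[mu]_(x in `[(-1)%R, 1%R]) (EFin \o f)^\- x)%E.
  rewrite -ge0_integral_uniform_law//; last exact: measurable_funeneg.
  by apply: eq_integral => t _; rewrite !funenegE.
rewrite posE negE [RHS]muleBr//.
by apply: fin_num_adde_defr; exact: integrable_pos_fin_num.
Qed.

Lemma integrable_exprn_uniform_law k :
  P.-integrable setT (fun t => (X t ^+ k)%:E).
Proof.
apply/integrableP; split.
  by apply/measurable_EFinP; apply: measurable_funX.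
pose g (x : R) := `|(x ^+ k)%:E|%E.
rewrite -[X in (X < _)%E]/(\int[P]_t g (X t))%E ge0_integral_uniform_law; last 2 first.
- by apply: measurableT_comp => //; apply/measurable_EFinP; exact: measurable_funX.
- by move=> x; rewrite abse_ge0.
have : mu.-integrable `[(-1)%R, 1%R] (fun x : R => (x ^+ k)%:E).
  apply: continuous_compact_integrable; first exact: segment_compact.
  by apply: continuous_subspaceT => x; exact: exprn_continuous.
by move=> /integrableP[_]; exact: lte_mul_pinfty.
Qed.

Lemma uniform_law_moment k :
  (\int[P]_t (X t ^+ k)%:E = (if odd k then 0 else (k.+1%:R)^-1)%:E)%E.
Proof.
have ck : continuous (fun x : R => x ^+ k) by exact: exprn_continuous.
rewrite (integral_uniform_law (f := fun x => x ^+ k)); last 2 first.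
- exact: continuous_measurable_fun.
- apply: continuous_compact_integrable; first exact: segment_compact.
  exact: continuous_subspaceT.
have dF (x : R) : is_derive x 1 (fun x : R => k.+1%:R^-1 * x ^+ k.+1) (x ^+ k).
  rewrite (_ : (fun x => _) = k.+1%:R^-1 \*: (id ^+ k.+1)); last first.
    by apply/funext => y /=; rewrite exprfctE.
  apply: is_derive_eq; rewrite /GRing.scale/= mulr1 mulrA mulVf ?mul1r ?pnatr_eq0//.
have cF : continuous (fun x : R => k.+1%:R^-1 * x ^+ k.+1).
  move=> x; apply: differentiable_continuous.
  by apply/derivable1_diffP; apply: ex_derive; exact: dF.
rewrite (@continuous_FTC2 _ _ (fun x : R => k.+1%:R^-1 * x ^+ k.+1)).
- rewrite -EFinB -EFinM expr1n mulr1; congr EFin.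
  rewrite -signr_odd/=; case: (odd k) => /=; rewrite ?expr0 ?expr1.
    by rewrite mulr1 subrr mulr0.
  by rewrite mulrN1 opprK -mulr2n mulrC -[_ *+ 2]mulr_natr mulfK// pnatr_eq0.
- by rewrite ltrN1_1.
- exact: continuous_subspaceT.
- split => [x _||]; first by apply: ex_derive; exact: dF.
    by apply: cvg_at_right_filter; exact: cF.
  by apply: cvg_at_left_filter; exact: cF.
- by move=> x _; rewrite derive1E; exact: (@derive_val _ _ _ _ _ _ _ (dF x)).
Qed.

End UniformMoments.

(** * Expectation of a product of independent variables *)

Section Decoupling.
Context (R : realType) (disp : measure_display) (T : measurableType disp)
  (P : probability T R) (X : {RV P >-> R}).

(** For W nonnegative, this is independence of the event X in B from the weight W,
c being the mean of W. *)
Definition decoupled (W : T -> R) (c : R) : Prop :=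
  forall B : set R, measurable B ->
    (\int[P]_t (\1_B (X t) * W t)%:E = c%:E * P (X @^-1` B))%E.

Lemma decoupled_nnsfun (W : T -> R) (c : R) (g : {nnsfun R >-> R}) :
  measurable_fun setT W -> (forall t, 0 <= W t) -> decoupled W c ->
  (\int[P]_t (g (X t) * W t)%:E =
   \sum_(y \in range g) (y%:E * (c%:E * P (X @^-1` (g @^-1` [set y])))))%E.
Proof.
move=> mW W0 dW.
have mB y : measurable (g @^-1` [set y]) by exact: measurable_sfunP.
have mI y : measurable_fun setT (fun t => \1_(g @^-1` [set y]) (X t) * W t).
  by apply: measurable_funM => //; apply: measurableT_comp.
have gE t : (g (X t) * W t)%:E =
    (\sum_(y \in range g) (y * (\1_(g @^-1` [set y]) (X t) * W t))%:E)%E.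
  rewrite fsumEFin//; congr EFin; rewrite [in LHS]fimfunE mulrC.
  rewrite mulr_fsumr//; apply: eq_fsbigr => y _.
  by rewrite mulrC mulrA.
under eq_integral do rewrite gE.
rewrite ge0_integral_fsum//; last 2 first.
- by move=> y; apply/measurable_EFinP; exact: measurable_funM.
- move=> y t _; rewrite lee_fin mulrA mulr_ge0//.
  have : (0 <= y%:E * (\1_(g @^-1` [set y]) (X t))%:E)%E by exact: nnfun_muleindic_ge0.
  by rewrite -EFinM lee_fin.
apply: eq_fsbigr => y; rewrite inE => -[x _ <-].
under eq_integral do rewrite EFinM.
rewrite ge0_integralZl ?dW// ?lee_fin//.
- by apply/measurable_EFinP.
- by move=> t _; rewrite lee_fin mulr_ge0.
Qed.

Lemma decoupled_cst1 : decoupled (cst 1) 1.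
Proof.
move=> B mB; rewrite mul1e; under eq_integral do rewrite /= mulr1.
rewrite -(setIT (X @^-1` B)) -integral_indic//; exact: measurable_funPTI.
Qed.

(** By monotone approximation of f by simple functions. *)
Lemma decoupled_ge0 (W : T -> R) (c : R) (f : R -> R) :
  measurable_fun setT W -> (forall t, 0 <= W t) -> 0 <= c -> decoupled W c ->
  measurable_fun setT f -> (forall x, 0 <= f x) ->
  (\int[P]_t (f (X t) * W t)%:E = c%:E * \int[P]_t (f (X t))%:E)%E.
Proof.
move=> mW W0 c0 dW mf f0.
have mEf : measurable_fun setT (EFin \o f) by exact/measurable_EFinP.
pose f_ := nnsfun_approx measurableT mEf.
have limE (V : T -> R) : measurable_fun setT V -> (forall t, 0 <= V t) ->
    (\int[P]_t (f (X t) * V t)%:E =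
     limn (fun n => \int[P]_t (f_ n (X t) * V t)%:E))%E.
  move=> mV V0; rewrite -monotone_convergence//=.
  - apply: eq_integral => t _; apply/esym/cvg_lim => //.
    apply: cvg_EFin; first exact: nearW.
    apply: cvgMl.
    have : EFin \o (f_^~ (X t)) @ \oo --> (f (X t))%:E.
      by apply: (@cvg_nnsfun_approx _ _ _ _ measurableT _ mEf) => // x _; rewrite lee_fin.
    by move/fine_cvg.
  - by move=> n; apply/measurable_EFinP; apply: measurable_funM => //; exact: measurableT_comp.
  - by move=> n t _; rewrite lee_fin mulr_ge0.
  - move=> t _ m n mn; rewrite lee_fin ler_wpM2r//.
    exact/lefP/nd_nnsfun_approx.
have lim1 : (\int[P]_t (f (X t))%:E = limn (fun n => \int[P]_t (f_ n (X t))%:E))%E.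
  have := limE (cst 1); under eq_integral do rewrite /= mulr1.
  move=> ->//; congr (limn _); apply/funext => n.
  by apply: eq_integral => t _; rewrite /= mulr1.
rewrite limE// lim1 -limeMl//.
  congr (limn _); apply/funext => n /=.
  rewrite (decoupled_nnsfun _ mW W0 dW).
  under [in RHS]eq_integral do rewrite -[f_ n _]mulr1.
  rewrite (@decoupled_nnsfun (cst 1) 1 (f_ n) _ _ decoupled_cst1)//.
  rewrite ge0_mule_fsumr//.
    by apply: eq_fsbigr => y _; rewrite mul1e muleCA.
  move=> y; rewrite mul1e; have [y0|y0] := ltP y 0.
    by rewrite preimage_nnfun0// preimage_set0 measure0 mule0.
  by rewrite mule_ge0// lee_fin.
apply: ereal_nondecreasing_is_cvgn => m n mn; apply: ge0_le_integral => //=.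
- by move=> t _; rewrite lee_fin.
- by apply/measurable_EFinP; exact: measurableT_comp.
- by apply/measurable_EFinP; exact: measurableT_comp.
- by move=> t _; rewrite lee_fin; exact/lefP/nd_nnsfun_approx.
Qed.

End Decoupling.

Section Independence.
Context (R : realType) (disp : measure_display) (T : measurableType disp)
  (P : probability T R) (n : nat) (X : 'I_n -> {RV P >-> R})
  (indX : mutually_independent X).

Local Notation replace F i g := (fun j => if j == i then g else F j).

Lemma prod_replace (U : Type) (F : 'I_n -> U) (g : U) (i : 'I_n) (h : 'I_n -> U -> R) :
  \prod_j h j (replace F i g j) = h i g * \prod_(j | j != i) h j (F j).
Proof.
rewrite (bigD1 i)//= eqxx; congr (_ * _).
by apply: eq_bigr => j /negbTE ->.
Qed.

Lemma measurable_prod_comp (F : 'I_n -> R -> R) (p : pred 'I_n) :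
  (forall i, measurable_fun setT (F i)) ->
  measurable_fun setT (fun t => \prod_(i | p i) F i (X i t)).
Proof.
move=> mF; under eq_fun do rewrite -big_filter.
by apply: measurable_prod => i _; exact: measurableT_comp.
Qed.

Lemma integral_prod_indic (B : 'I_n -> set R) : (forall i, measurable (B i)) ->
  (\int[P]_t (\prod_i \1_(B i) (X i t))%:E =
   (\prod_i fine (P (X i @^-1` B i)))%:E)%E.
Proof.
move=> mB; pose I := \bigcap_(i in [set: 'I_n]) (X i @^-1` B i).
have mI : measurable I.
  by apply: fin_bigcap_measurable => // i _; exact: measurable_funPTI.
have IE t : \prod_i \1_(B i) (X i t) = \1_I t :> R.
  rewrite [in RHS]indicE; case: (boolP (t \in I)); rewrite ?inE ?notin_setE.
    by move=> It; apply: big1 => i _; rewrite indicE mem_set//; exact: It.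
  move=> nIt; have [i nB] : exists i, ~ B i (X i t).
    by apply/existsNP => h; apply: nIt => i _; exact: h.
  by rewrite (bigD1 i)//= indicE memNset// mul0r.
under eq_integral do rewrite IE.
rewrite integral_indic// setIT.
have := indX (J := [set: 'I_n]%SET) (B := B) (fun i _ => mB i).
rewrite (_ : [set` _] = [set: 'I_n]); last by apply/seteqP; split => i //=; rewrite inE.
move=> hI; rewrite [LHS]hI [LHS](eq_bigl xpredT) => [|i]; last by rewrite inE.
elim/big_ind2 : _ => //= [x _ y _ -> ->|i _]; first by rewrite EFinM.
by rewrite fineK// fin_num_measure//; exact: measurable_funPTI.
Qed.

(** Independence concerns indicator functions.  They are replaced by the given
functions one index at a time: the first k functions are arbitrary in the
induction hypothesis, and the product of the other factors is the weight from
which the next variable is decoupled. *)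
Lemma integral_prod_ge0 (F : 'I_n -> R -> R) (e : 'I_n -> R) :
  (forall i, measurable_fun setT (F i)) -> (forall i x, 0 <= F i x) ->
  (forall i, \int[P]_t (F i (X i t))%:E = (e i)%:E)%E ->
  (\int[P]_t (\prod_i F i (X i t))%:E = (\prod_i e i)%:E)%E.
Proof.
move=> mF F0 eF.
suff gen k : forall (F : 'I_n -> R -> R) (e : 'I_n -> R),
    (forall i, measurable_fun setT (F i)) -> (forall i x, 0 <= F i x) ->
    (forall i, \int[P]_t (F i (X i t))%:E = (e i)%:E)%E ->
    (forall i : 'I_n, (k <= i)%N -> exists2 B, measurable B & F i = \1_B) ->
    (\int[P]_t (\prod_i F i (X i t))%:E = (\prod_i e i)%:E)%E.
  by apply: (gen n) => // i; rewrite leqNgt ltn_ord.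
elim: k {F e mF F0 eF} => [|k IH] F e mF F0 eF Find.
  have [B BP] : {B : 'I_n -> set R & forall i, measurable (B i) /\ F i = \1_(B i)}.
    apply: (@choice _ _ (fun i B => measurable B /\ F i = \1_B)) => i.
    by have [B] := Find i (leq0n _); exists B.
  under eq_integral do under eq_bigr do rewrite (BP _).2.
  rewrite integral_prod_indic; last by move=> i; exact: (BP i).1.
  congr EFin; apply: eq_bigr => i _; have := eF i; rewrite (BP i).2.
  rewrite integral_indic//; last by apply: measurable_funPTI; exact: (BP i).1.
  by rewrite setIT => ->.
have [kn|nk] := ltnP k n; last first.
  by apply: IH => // i /(leq_trans nk); rewrite leqNgt ltn_ord.
pose i0 := Ordinal kn.
pose W t := \prod_(i | i != i0) F i (X i t).
pose c := \prod_(i | i != i0) e i.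
have e0 i : 0 <= e i.
  by rewrite -lee_fin -eF; apply: integral_ge0 => t _; rewrite lee_fin.
have dW : decoupled (X i0) W c.
  move=> B mB; pose p := fine (P (X i0 @^-1` B)).
  have pE : P (X i0 @^-1` B) = p%:E.
    by rewrite fineK// fin_num_measure//; exact: measurable_funPTI.
  have := IH (replace F i0 (\1_B)) (replace e i0 p).
  rewrite (prod_replace e p i0 (fun _ x => x)) pE -EFinM mulrC -/c => <-.
  - apply: eq_integral => t _.
    by rewrite (prod_replace F (\1_B) i0 (fun i f => f (X i t))).
  - by move=> i; case: eqVneq.
  - by move=> i x; case: eqVneq.
  - move=> i; case: eqVneq => [->|_] //.
    by rewrite integral_indic ?setIT//; exact: measurable_funPTI.
  - move=> i ki; case: eqVneq => [_|ii0]; first by exists B.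
    by apply: Find; rewrite ltn_neqAle ki andbT eq_sym.
under eq_integral do rewrite (bigD1 i0)//=.
rewrite (decoupled_ge0 (X := X i0) (W := W) (c := c))//.
- by rewrite eF (bigD1 i0)//= -EFinM mulrC.
- exact: measurable_prod_comp.
- by move=> t; apply: prodr_ge0.
- exact: prodr_ge0.
Qed.

Lemma integrable_prod (F : 'I_n -> R -> R) :
  (forall i, measurable_fun setT (F i)) ->
  (forall i, P.-integrable setT (fun t => (F i (X i t))%:E)) ->
  P.-integrable setT (fun t => (\prod_i F i (X i t))%:E).
Proof.
move=> mF iF; apply/integrableP; split.
  by apply/measurable_EFinP; exact: measurable_prod_comp.
under eq_integral do rewrite abse_EFin normr_prod.
rewrite (@integral_prod_ge0 (fun i x => `|F i x|)
  (fun i => fine (\int[P]_t (`|F i (X i t)|)%:E)%E)) ?ltry//.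
  by move=> i; exact: measurableT_comp.
move=> i; rewrite fineK// ge0_fin_numE; last by apply: integral_ge0.
by have /integrableP[_] := iF i.
Qed.

(** The sign restriction is removed one index at a time, by splitting one factor
into its positive and negative parts; the product is integrable because the
nonnegative case applies to the absolute values. *)
Lemma integral_prod_independent (F : 'I_n -> R -> R) (e : 'I_n -> R) :
  (forall i, measurable_fun setT (F i)) ->
  (forall i, P.-integrable setT (fun t => (F i (X i t))%:E)) ->
  (forall i, \int[P]_t (F i (X i t))%:E = (e i)%:E)%E ->
  (\int[P]_t (\prod_i F i (X i t))%:E = (\prod_i e i)%:E)%E.
Proof.
move=> mF iF eF.
suff gen k : forall (F : 'I_n -> R -> R) (e : 'I_n -> R),
    (forall i, measurable_fun setT (F i)) ->
    (forall i, P.-integrable setT (fun t => (F i (X i t))%:E)) ->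
    (forall i, \int[P]_t (F i (X i t))%:E = (e i)%:E)%E ->
    (forall i : 'I_n, (k <= i)%N -> forall x, 0 <= F i x) ->
    (\int[P]_t (\prod_i F i (X i t))%:E = (\prod_i e i)%:E)%E.
  by apply: (gen n) => // i; rewrite leqNgt ltn_ord.
elim: k {F e mF iF eF} => [|k IH] F e mF iF eF F0.
  by apply: integral_prod_ge0 => // i x; exact: F0.
have [kn|nk] := ltnP k n; last first.
  by apply: IH => // i /(leq_trans nk); rewrite leqNgt ltn_ord.
pose i0 := Ordinal kn.
pose pos (x : R) : R := Num.max (F i0 x) 0.
pose neg (x : R) : R := Num.max (- F i0 x) 0.
have FE x : F i0 x = pos x - neg x.
  by rewrite /pos /neg; case: (lerP (F i0 x) 0) => h; case: (lerP (- F i0 x) 0) => h'; lra.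
have replaceP (g : R -> R) : measurable_fun setT g -> (forall x, 0 <= g x) ->
    (forall x, g x <= `|F i0 x|) ->
  exists a : R, [/\ (\int[P]_t (g (X i0 t))%:E = a%:E)%E,
    P.-integrable setT (fun t => (g (X i0 t))%:E),
    P.-integrable setT (fun t => (\prod_i replace F i0 g i (X i t))%:E) &
    (\int[P]_t (\prod_i replace F i0 g i (X i t))%:E =
     (a * \prod_(i | i != i0) e i)%:E)%E].
  move=> mg g0 gF.
  have ig : P.-integrable setT (fun t => (g (X i0 t))%:E).
    apply: le_integrable (iF i0) => //.
      by apply/measurable_EFinP; exact: measurableT_comp.
    by move=> t _; rewrite !abse_EFin lee_fin ger0_norm.
  exists (fine (\int[P]_t (g (X i0 t))%:E)%E).
  have aE : (\int[P]_t (g (X i0 t))%:E = (fine (\int[P]_t (g (X i0 t))%:E))%:E)%E.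
    by rewrite fineK//; exact: integrable_fin_num.
  have mr i : measurable_fun setT (replace F i0 g i) by case: eqVneq.
  have ir i : P.-integrable setT (fun t => (replace F i0 g i (X i t))%:E).
    by case: eqVneq => [->|].
  split => //; first exact: (integrable_prod mr ir).
  rewrite (IH (replace F i0 g) (replace e i0 (fine (\int[P]_t (g (X i0 t))%:E)%E)))//.
  - by rewrite (prod_replace e _ i0 (fun _ x => x)).
  - by move=> i; case: eqVneq => [->|].
  - move=> i ki; case: eqVneq => [_|ii0]; first exact: g0.
    by apply: F0; rewrite ltn_neqAle ki andbT eq_sym.
have [|||a [aE ia iA AE]] := replaceP pos.
- by apply: measurable_maxr.
- by move=> x; rewrite le_max lexx orbT.
- by move=> x; rewrite ge_max ler_norm normr_ge0.
have [|||b [bE ib iB BE]] := replaceP neg.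
- by apply: measurable_maxr => //; exact: measurableT_comp.
- by move=> x; rewrite le_max lexx orbT.
- by move=> x; rewrite ge_max -normrN ler_norm normr_ge0.
have eab : e i0 = a - b.
  apply: EFin_inj; rewrite -eF EFinB -aE -bE -integralB_EFin//.
  by apply: eq_integral => t _; rewrite FE EFinB.
rewrite [in RHS](bigD1 i0)//= eab mulrBl EFinB -AE -BE -integralB_EFin//.
apply: eq_integral => t _; rewrite -EFinB; congr EFin.
rewrite !(prod_replace F _ i0 (fun i f => f (X i t))) -mulrBl -FE.
by rewrite (bigD1 i0).
Qed.

End Independence.

(** * The norm as a coefficient *)

Section Expectation.
Context (R : realType) (disp : measure_display) (T : measurableType disp)
  (P : probability T R) (n : nat) (X : 'I_n -> {RV P >-> R})
  (hX : iid_with_law (uniformN11 R) X).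

Lemma integral_sum_exprn (l : 'I_n -> R) d :
  (\int[P]_t ((\sum_i l i * X i t) ^+ d / d`!%:R)%:E =
   ((\prod_(i < n) \poly_(k < d.+1)
      (l i ^+ k / k`!%:R * (if odd k then 0 else k.+1%:R^-1)))`_d)%:E)%E.
Proof.
pose F (f : {ffun 'I_n -> 'I_d.+1}) i (x : R) : R := (l i * x) ^+ f i / (f i)`!%:R.
have FE f i x : F f i x = l i ^+ f i / (f i)`!%:R * x ^+ f i.
  by rewrite /F exprMn mulrAC.
have mF f i : measurable_fun setT (F f i).
  by apply: measurable_funM => //; apply: measurable_funX; apply: measurable_funM.
have iF f i : P.-integrable setT (fun t => (F f i (X i t))%:E).
  under eq_fun do rewrite FE EFinM.
  by apply: integrableZl => //; exact: (integrable_exprn_uniform_law (hX.2 i)).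
have eF f i : (\int[P]_t (F f i (X i t))%:E =
    (l i ^+ f i / (f i)`!%:R * (if odd (f i) then 0 else (f i).+1%:R^-1))%:E)%E.
  under eq_integral do rewrite FE EFinM.
  rewrite integralZl//; last exact: (integrable_exprn_uniform_law (hX.2 i)).
  by rewrite (uniform_law_moment (hX.2 i)) EFinM.
rewrite coef_prod_poly.
under eq_integral => t _.
  rewrite -(coef_prod_exp_poly (index_enum 'I_n) (fun i => l i * X i t) (leqnn d)).
  rewrite coef_prod_poly -sumEFin.
  over.
rewrite integral_sum//; last by move=> f; exact: (integrable_prod hX.1 (mF f) (iF f)).
rewrite -sumEFin; apply: eq_bigr => f _.
exact: (integral_prod_independent hX.1 (mF f) (iF f) (eF f)).
Qed.

(** Gamma(d + 1) = d! cancels the factorial, and |x|^d = x^d as d is even. *)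
Lemma random_vector_norm_even (G : sgraph n) K : (0 < K)%N ->
  random_vector_norm G X (2 * K)%:R ^+ (2 * K) =
  (\prod_(x <- [seq eigenvalues_mx (adjmx R G) 0 i ^+ 2 | i <- enum 'I_n])
     sinhc_poly K x)`_K.
Proof.
move=> K0; set d := (2 * K)%N; pose l i := eigenvalues_mx (adjmx R G) 0 i.
set C := RHS.
have CE : (\int[P]_t ((\sum_i l i * X i t) ^+ d / d`!%:R)%:E = C%:E)%E.
  rewrite integral_sum_exprn /C big_map big_enum/=; congr EFin.
  under eq_bigr do rewrite -sinhc_poly_comp_sqr.
  by rewrite -rmorph_prod/= coef_comp_poly_Xn// dvdn_mulr// mulKn.
have d0 : d%:R != 0 :> R by rewrite pnatr_eq0 muln_eq0/= -lt0n.
have dfact : 0 < d`!%:R :> R by rewrite ltr0n fact_gt0.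
have even_d : ~~ odd d by rewrite oddM.
have C0 : 0 <= C.
  rewrite -lee_fin -CE; apply: integral_ge0 => t _; rewrite lee_fin.
  by apply: divr_ge0; [exact: exprn_even_ge0|exact: ltW].
have momE : fine 'E_P[fun w => `|\sum_i l i * X i w| `^ d%:R] = d`!%:R * C.
  rewrite unlock.
  have -> : (\int[P]_w (`|\sum_i l i * X i w| `^ d%:R)%:E)%E = (d`!%:R * C)%:E.
    rewrite EFinM -CE -ge0_integralZl//.
    - apply: eq_integral => t _; rewrite powR_mulrn// -EFinM; congr EFin.
      rewrite -normrX ger0_norm ?exprn_even_ge0//.
      by rewrite mulrCA mulfV ?mulr1// gt_eqF.
    - apply/measurable_EFinP; apply: measurable_funM => //; apply: measurable_funX.
      by apply: measurable_sum => i; apply: measurable_funM.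
    - move=> t _; rewrite lee_fin.
      by apply: divr_ge0; [exact: exprn_even_ge0|exact: ltW].
  by [].
rewrite /random_vector_norm momE Gamma_fact exprMn -!powR_mulrn ?powR_ge0//.
rewrite -!powRrM mulNr mulVf// powR_inv1 ?ler0n// powRr1 ?mulr_ge0 ?ler0n//.
by rewrite mulKf// gt_eqF.
Qed.

End Expectation.

(** * The lower bound and the extremal graphs *)

Theorem theorem4p7 (R : realType) (disp : measure_display)
    (T : measurableType disp) (P : probability T R)
    (n : nat) (G : sgraph n) (X : 'I_n -> {RV P >-> R})
    (hX : iid_with_law (uniformN11 R) X)
    (d : nat) (hd : (2 <= d)%N) (hdeven : ~~ odd d) :
  let m := num_edges G in
  let bound : R := 2 * (2 * Num.sqrt m%:R) ^+ d / (d + 2)`!%:R in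
  [/\ triangle_free G \/ (square_free G /\ (9 <= m)%N) ->
        bound <= random_vector_norm G X d%:R ^+ d,
      is_complete_bipartite G ->
        triangle_free G /\ random_vector_norm G X d%:R ^+ d = bound
    & is_star G ->
        square_free G /\ random_vector_norm G X d%:R ^+ d = bound].
Proof.
move=> m bound; pose K := (d %/ 2)%N.
have dE : d = (2 * K)%N by rewrite mulnC divnK// dvdn2.
have K0 : (0 < K)%N by rewrite divn_gt0.
pose s := [seq eigenvalues_mx (adjmx R G) 0 i ^+ 2 | i <- enum 'I_n].
have normE : random_vector_norm G X d%:R ^+ d = (\prod_(x <- s) sinhc_poly K x)`_K.
  by rewrite dE random_vector_norm_even.
have boundE : bound = m%:R ^+ K * 2 ^+ (2 * K).+1 / (2 * K.+1)`!%:R.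
  rewrite /bound dE (_ : (2 * K + 2 = 2 * K.+1)%N); last by rewrite mulnS addnC.
  congr (_ / _); rewrite exprMn [Num.sqrt _ ^+ _]exprM sqr_sqrtr ?ler0n//.
  by rewrite [RHS]mulrC mulrA -exprS.
have sumE : \sum_(x <- s) x = m%:R *+ 2.
  by rewrite big_map big_enum/= sum_sqr_eigenvalues.
have cut_norm (A : {set 'I_n}) : (forall x y, G x y = ((x \in A) != (y \in A))) ->
    random_vector_norm G X d%:R ^+ d = bound.
  move=> GA; rewrite normE boundE; apply: coef_prod_sinhc_poly_eq => //.
  by move=> _ /mapP[i _ ->]; exact: cut_graph_sqr_eigenvalue GA.
split=> [hG|[A [_ _ GA]]|starG].
- rewrite normE boundE; apply: coef_prod_sinhc_poly_ge => //.
  by move=> _ /mapP[i _ ->]; rewrite sqr_ge0 eigenvalue_sqr_le.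
- by split; [exact: cut_graph_triangle_free GA|exact: cut_norm GA].
- split; first exact: star_square_free.
  have [c Gc] := starG; apply: (cut_norm [set c]%SET) => x y.
  by rewrite Gc !finset.in_set1.
Qed.
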